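(* Let $\rho$ be an $n$-qubit state with bipartition $A|B$ that commutes with the total number operator $Q=\sum_i(I-Z_i)/2$. Then for every charge sector $q$ (with nonzero block $\rho^\Gamma_{(q)}$), $\mathcal{E}_4^{(q)}(\rho)\le\mathcal{E}(\rho)$, and, combining all sectors, $\mathcal{E}_4^{\mathrm{SR}}(\rho)\le\mathcal{E}(\rho)$ and $\tilde{\mathcal{E}}_2^{\mathrm{SR}}(\rho)\le\mathcal{E}(\rho)$.
   Context: $Z_i$ is the Pauli $Z$ operator on qubit $i$; $Q=Q_A+Q_B$ with $Q_{A}=\sum_{i\in A}(I-Z_i)/2$ and $Q_{B}=\sum_{i\in B}(I-Z_i)/2$. The partial transpose on $B$ is $(X_A\otimes Y_B)^\Gamma=X_A\otimes Y_B^T$, and $\mathcal{E}(\rho)=\ln\|\rho^\Gamma\|_1$. If $\rho$ commutes with $Q$, then $\rho^\Gamma$ commutes with $Q_A-Q_B^T$ and decomposes into blocks $\rho^\Gamma_{(q)}$ labelled by the eigenvalues $q$ of $Q_A-Q_B^T$. Define $p_\alpha^{(q)}=\mathrm{tr}\big((\rho_{(q)}^\Gamma)^\alpha\big)$, $\mathcal{E}_4^{(q)}(\rho)=\frac12\ln\big((p_2^{(q)})^3/p_4^{(q)}\big)$, $\mathcal{E}_4^{\mathrm{SR}}(\rho)=\ln\Big(\sum_q\sqrt{(p_2^{(q)})^3/p_4^{(q)}}\Big)$, and $\tilde{\mathcal{E}}_2^{\mathrm{SR}}(\rho)=\ln\Big(\sum_q\sqrt{p_2^{(q)}}\Big)$,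 sums running over sectors with nonzero block. *)

(* Defs.v *)
From HB Require Import structures.
From mathcomp Require Import all_boot all_order all_algebra.
From mathcomp Require Import sesquilinear spectral complex.
From mathcomp Require Import boolp classical_sets functions cardinality fsbigop.
From mathcomp Require Import reals exp.

Set Implicit Arguments.
Unset Strict Implicit.
Unset Printing Implicit Defensive.

Import Order.TTheory GRing.Theory Num.Theory.
Local Open Scope ring_scope.
Local Open Scope sesquilinear_scope.

(* Computational basis of the qubits indexed by a finite type I: bit strings
   over I.  Matrices are indexed by the ordinals enumerating these strings, so
   that a system of n qubits has dimension #|{ffun 'I_n -> 'I_2}| = 2 ^ n. *)
Definition bits (I : finType) : finType := {ffun I -> 'I_2}.

Definition op (R : rcfType) (I : finType) := 'M[R[i]]_#|bits I|.

Definition ket (I : finType) (x : 'I_#|bits I|) : bits I := enum_val x.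

Section Qubits.
Variables (R : rcfType) (n : nat).
Local Notation opn := (op R 'I_n).

Definition pauliZ : 'M[R[i]]_2 := diag_mx (\row_(a < 2) (-1) ^+ a).

(* I (x) ... (x) M (x) ... (x) I with M acting on qubit i. *)
Definition on_qubit (i : 'I_n) (M : 'M[R[i]]_2) : opn :=
  \matrix_(x, y) (M (ket x i) (ket y i) *
                  [forall j, (j != i) ==> (ket x j == ket y j)]%:R).

Definition numop (S : {set 'I_n}) : opn :=
  \sum_(i in S) 2^-1 *: (1%:M - on_qubit i pauliZ).

(* x outside B, y inside B. *)
Definition splice (B : {set 'I_n}) (x y : bits 'I_n) : bits 'I_n :=
  [ffun i => if i \in B then y i else x i].

(* <x_A x_B| X^Gamma |y_A y_B> = <x_A y_B| X |y_A x_B>. *)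
Definition ptrans (B : {set 'I_n}) (X : opn) : opn :=
  \matrix_(x, y) X (enum_rank (splice B (ket x) (ket y)))
                   (enum_rank (splice B (ket y) (ket x))).

Definition density (rho : opn) : Prop :=
  [/\ rho \is hermsymmx,
      forall v : 'rV[R[i]]_#|bits 'I_n|, 0 <= (v *m rho *m v ^t*) 0 0
    & \tr rho = 1].

Definition imbalance (A B : {set 'I_n}) : opn := numop A - (numop B)^T.

(* Orthogonal projector onto the q-eigenspace of Q_A - Q_B^T.  The library's
   eigenspaces and projectors act on row vectors; since Q_A - Q_B^T is
   Hermitian this is also the usual spectral projector on column vectors. *)
Definition charge_proj (A B : {set 'I_n}) (q : R[i]) : opn :=
  proj_ortho (eigenspace (imbalance A B) q).

Definition block (A B : {set 'I_n}) (rho : opn) (q : R[i]) : opn :=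
  charge_proj A B q *m ptrans B rho *m charge_proj A B q.

Definition sector (A B : {set 'I_n}) (rho : opn) (q : R[i]) : Prop :=
  eigenvalue (imbalance A B) q /\ block A B rho q != 0.

(* The traces are real, the blocks being Hermitian when rho is. *)
Definition ptmoment (A B : {set 'I_n}) (rho : opn) (alpha : nat) (q : R[i]) : R :=
  complex.Re (\tr (block A B rho q ^+ alpha)).

End Qubits.

(* tr sqrt(X^* X), the square root being taken on the spectrum. *)
Definition trnorm (R : rcfType) (m : nat) (X : 'M[R[i]]_m) : R :=
  \sum_(i < m) Num.sqrt (complex.Re (spectral_diag (X ^t* *m X) 0 i)).

Section Negativities.
Variables (R : realType) (n : nat) (A B : {set 'I_n}) (rho : op R 'I_n).
Local Notation p := (ptmoment A B rho).
Local Open Scope classical_set_scope.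

Definition sectors : set R[i] := [set q | sector A B rho q].

Definition lognegativity : R := ln (trnorm (ptrans B rho)).

Definition E4 (q : R[i]) : R := 2^-1 * ln (p 2 q ^+ 3 / p 4 q).

Definition E4SR : R := ln (\sum_(q \in sectors) Num.sqrt (p 2 q ^+ 3 / p 4 q)).

Definition E2SR : R := ln (\sum_(q \in sectors) Num.sqrt (p 2 q)).

(* A \sum over an infinite support would be 0 by convention; this rules it out. *)
Lemma finite_sectors : finite_set sectors.
Proof.
have [r Er] := closed_field_poly_normal (char_poly (imbalance R A B)).
apply: (@sub_finite_set _ _ [set` r]); last exact: finite_seq.
move=> q [+ _]; rewrite eigenvalue_root_char /= {1}Er.
rewrite (monicP (char_poly_monic _)) scale1r root_prod_XsubC.
by [].
Qed.

End Negativities.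

(* X_A (x) Y_B, with X_A acting on the qubits outside B and Y_B on those in B. *)
Definition tensor (R : rcfType) (n : nat) (B : {set 'I_n})
    (X : op R {i | i \notin B}) (Y : op R {i | i \in B}) : op R 'I_n :=
  let res (P : pred 'I_n) (x : bits 'I_n) : bits {i | P i} :=
    [ffun i => x (val i)] in
  \matrix_(x, y)
    (X (enum_rank (res (fun i => i \notin B) (ket x)))
       (enum_rank (res (fun i => i \notin B) (ket y))) *
     Y (enum_rank (res (fun i => i \in B) (ket x)))
       (enum_rank (res (fun i => i \in B) (ket y)))).

Lemma ptrans_tensor (R : rcfType) (n : nat) (B : {set 'I_n})
    (X : op R {i | i \notin B}) (Y : op R {i | i \in B}) :
  ptrans B (tensor X Y) = tensor X Y^T.
Proof.
apply/matrixP => x y; rewrite !mxE /ket !enum_rankK.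
congr (X (enum_rank _) (enum_rank _) * Y (enum_rank _) (enum_rank _));
  apply/ffunP => -[i Bi]; rewrite !ffunE /= ?Bi //; by rewrite (negbTE Bi).
Qed.

(* Main.v *)
Require Import Defs.
From mathcomp Require Import all_boot all_order all_algebra.
From mathcomp Require Import complex reals.
From mathcomp Require Import sesquilinear spectral ring.
From mathcomp Require Import classical_sets cardinality fsbigop exp.
Local Open Scope ring_scope.

Set Implicit Arguments.
Unset Strict Implicit.
Unset Printing Implicit Defensive.

Import Order.TTheory GRing.Theory Num.Theory.
Local Open Scope sesquilinear_scope.

(** Let [M] be the partial transpose of [rho] and [P_q] the coordinate projector
    onto the basis states of charge [q].  As [M] preserves the charge, the block of
    charge [q] to the power [k > 0] is [P_q M ^ k]; diagonalizing [M = U^* L U] gives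
    [p_k = \sum_i w_i l_i ^ k], where [w_i >= 0] is the diagonal of [U P_q U^*].
    Hoelder's inequality yields [sqrt (p_2 ^ 3 / p_4) <= \sum_i w_i `|l_i|], and
    since the weights [w_i] of the different charges add up to at most 1, the sum
    over [q] is at most [\sum_i `|l_i|], the trace norm of [M].  Finally
    [p_4 <= p_2 ^ 2] bounds [sqrt p_2] by [sqrt (p_2 ^ 3 / p_4)].  The trace norm is
    at least [\tr M = 1], so that taking logarithms is harmless. *)

(** * Inequalities between weighted power sums *)

Section RealSums.
Variables (R : realFieldType) (I : finType).
Implicit Types u a b w : I -> R.

(** Lagrange's identity: twice the difference of the two sides is a double sum of squares with
    weights [u i * u j]. *)
Lemma weighted_cauchy_schwarz u a b : (forall i, 0 <= u i) ->
  (\sum_i u i * (a i * b i)) ^+ 2 <=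
  (\sum_i u i * a i ^+ 2) * (\sum_i u i * b i ^+ 2).
Proof.
move=> u0; rewrite -subr_ge0 -(pmulr_rge0 _ (ltr0n R 2)).
suff -> : 2%:R * ((\sum_i u i * a i ^+ 2) * (\sum_i u i * b i ^+ 2) -
    (\sum_i u i * (a i * b i)) ^+ 2) =
    \sum_i \sum_j u i * u j * (a i * b j - a j * b i) ^+ 2.
  by do 2!apply: sumr_ge0 => ? _; rewrite mulr_ge0 ?sqr_ge0 ?mulr_ge0.
have prodE f g : (\sum_i f i) * (\sum_i g i) = \sum_i \sum_j f i * g j :> R.
  by rewrite mulr_suml; apply: eq_bigr => i _; rewrite mulr_sumr.
(* Of the two copies of the product one is swapped, so that the expansion yields both
   [a i ^+ 2 * b j ^+ 2] and [b i ^+ 2 * a j ^+ 2]. *)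
rewrite mulrBr mulr_natl mulr2n {2}[_ * (\sum_i u i * b i ^+ 2)]mulrC.
rewrite expr2 !prodE mulr_sumr -sumrN -!big_split; apply: eq_bigr => i _ /=.
rewrite mulr_sumr -sumrN -!big_split; apply: eq_bigr => j _ /=; ring.
Qed.

(* Cauchy-Schwarz twice: [s2 ^+ 2 <= s1 * s3] and [s3 ^+ 2 <= s2 * s4], where
   [sk] is the weighted sum of the [k]-th powers of [`|a|]. *)
Lemma weighted_moment_holder w a : (forall i, 0 <= w i) ->
  (\sum_i w i * a i ^+ 2) ^+ 3 <=
  (\sum_i w i * `|a i|) ^+ 2 * \sum_i w i * a i ^+ 4.
Proof.
move=> w0; set s2 := \sum_i w i * a i ^+ 2; set s4 := \sum_i w i * a i ^+ 4.
set s1 := \sum_i w i * `|a i|; pose s3 := \sum_i w i * `|a i| ^+ 3.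
have s13 : s2 ^+ 2 <= s1 * s3.
  have := @weighted_cauchy_schwarz (fun i => w i * `|a i|) (fun=> 1)
    (fun i => `|a i|) (fun i => mulr_ge0 (w0 i) (normr_ge0 _)).
  congr (_ ^+ 2 <= _ * _); apply: eq_bigr => i _.
  - by rewrite mul1r -mulrA -expr2 real_normK ?num_real.
  - by rewrite expr1n mulr1.
  - by rewrite -mulrA -exprS.
have s24 : s3 ^+ 2 <= s2 * s4.
  have := @weighted_cauchy_schwarz w (fun i => `|a i|) (fun i => `|a i| ^+ 2) w0.
  congr (_ ^+ 2 <= _ * _); apply: eq_bigr => i _.
  - by rewrite real_normK ?num_real.
  - by rewrite real_normK ?num_real // -exprM.
have s1_ge0 : 0 <= s1 by apply: sumr_ge0 => i _; rewrite mulr_ge0.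
have s2_ge0 : 0 <= s2 by apply: sumr_ge0 => i _; rewrite mulr_ge0 ?sqr_ge0.
have s4_ge0 : 0 <= s4.
  by apply: sumr_ge0 => i _; rewrite mulr_ge0 // (exprM _ 2 2) sqr_ge0.
have [->|s2_neq0] := eqVneq s2 0; first by rewrite expr0n /= mulr_ge0 ?sqr_ge0.
have s2_gt0 : 0 < s2 by rewrite lt_def s2_neq0.
(* Multiplied by [s2], the left side becomes the square of [s2 ^+ 2], to which [s13] and then [s24]
   apply. *)
rewrite -(ler_pM2l s2_gt0) -exprS (exprM _ 2 2).
apply: (@le_trans _ _ ((s1 * s3) ^+ 2)).
  by rewrite lerXn2r ?nnegrE ?sqr_ge0 // (le_trans _ s13) ?sqr_ge0.
by rewrite exprMn [leRHS]mulrCA ler_wpM2l ?sqr_ge0.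
Qed.

Lemma sum_sqr_le a : (forall i, 0 <= a i) -> \sum_i a i ^+ 2 <= (\sum_i a i) ^+ 2.
Proof.
move=> a0; rewrite expr2 mulr_suml; apply: ler_sum => i _.
rewrite expr2 ler_wpM2l // (bigD1 i) //= lerDl; exact: sumr_ge0.
Qed.

End RealSums.

(** * Moments and trace norm of a Hermitian matrix through its spectrum *)

Section SpectralWeights.
Variables (R : rcfType) (N : nat).
Local Notation C := R[i].
Implicit Types (M U : 'M[C]_N) (P : pred 'I_N).

Lemma Re_realM (r : R) (z : C) : complex.Re (r%:C%C * z) = r * complex.Re z.
Proof. by case: z => a b /=; rewrite mul0r subr0. Qed.

Definition amp2 U i j : R := complex.Re (U i j * (U i j)^*).

Lemma amp2_ge0 U i j : 0 <= amp2 U i j.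
Proof.
have /(le_trans _) : 0 <= U i j * (U i j)^* by exact: mul_conjC_ge0.
by rewrite -ler0c /amp2 RRe_real ?ger0_real ?mul_conjC_ge0.
Qed.

Lemma amp2_row_sum U i : U \is unitarymx -> \sum_j amp2 U i j = 1.
Proof.
move=> /unitarymxP /matrixP /(_ i i); rewrite !mxE eqxx mulr1n => /(congr1 (@complex.Re R)).
rewrite raddf_sum => U1; apply: etrans U1.
by apply: eq_bigr => j _; rewrite !mxE.
Qed.

Lemma amp2_col_sum U j : U \is unitarymx -> \sum_i amp2 U i j = 1.
Proof.
rewrite -trmx_unitary => /(amp2_row_sum j) <-.
by apply: eq_bigr => i _; rewrite /amp2 !mxE.
Qed.

Lemma hermitian_conjTE M : M \is hermsymmx -> M^t* = M.
Proof.
by move=> hM; have := is_hermitianmxP _ _ _ hM; rewrite expr0 scale1r => <-.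
Qed.

Definition eigval M i : R := complex.Re (spectral_diag M 0 i).

Lemma eigvalE M i : M \is hermsymmx -> spectral_diag M 0 i = (eigval M i)%:C%C.
Proof.
by move=> /hermitian_spectral_diag_real /mxOverP /(_ 0 i) r; rewrite RRe_real.
Qed.

Lemma hermitian_expE M k : M \is hermsymmx ->
  M ^+ k = (spectralmx M)^t* *m diag_mx (\row_i ((eigval M i)%:C%C ^+ k)) *m spectralmx M.
Proof.
move=> hM; have := spectral_unitarymx M.
have /orthomx_spectralP := hermitian_normalmx hM.
rewrite (invmx_unitary (spectral_unitarymx M)).
have -> : spectral_diag M = \row_i (eigval M i)%:C%C.
  by apply/rowP => i; rewrite mxE eigvalE.
move: (spectralmx M) (eigval M) => U l ME Uu.
have UU : U^t* *m U = 1%:M by rewrite -(invmx_unitary Uu) mulVmx ?unitarymx_unit.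
elim: k => [|k IH].
  suff -> : diag_mx (\row_i ((l i)%:C%C ^+ 0)) = 1%:M :> 'M[C]_N by rewrite mulmx1 UU.
  by apply/matrixP => i j; rewrite !mxE expr0.
rewrite exprS IH -mulmxE {1}ME -!mulmxA (mulmxA U) (unitarymxP Uu) mul1mx.
rewrite (mulmxA (diag_mx _)) mulmx_diag.
by congr (_ *m (diag_mx _ *m _)); apply/rowP => i; rewrite !mxE exprS.
Qed.

Definition spectral_weight M P i : R := \sum_(x | P x) amp2 (spectralmx M) i x.

Lemma spectral_weight_ge0 M P i : 0 <= spectral_weight M P i.
Proof. by apply: sumr_ge0 => x _; exact: amp2_ge0. Qed.

Definition restrmx P : 'M[C]_N := diag_mx (\row_x (P x)%:R).

(** With [M ^+ k] diagonalized, each basis state [x] in [P] contributes the sum over [i] of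
    [amp2 U i x] times the power of the eigenvalue; exchanging the sums collects the weights. *)
Lemma restr_momentE M P k : M \is hermsymmx ->
  complex.Re (\tr (restrmx P *m M ^+ k)) =
  \sum_i spectral_weight M P i * eigval M i ^+ k.
Proof.
move=> hM; rewrite hermitian_expE // /mxtrace raddf_sum.
under [RHS]eq_bigr do rewrite /spectral_weight mulr_suml.
rewrite (exchange_big_dep predT) //=.
apply: eq_bigr => x _; rewrite mul_diag_mx !mxE.
case: (P x); last by rewrite mul0r big_pred0.
rewrite mul1r raddf_sum; apply: eq_bigr => i _.
rewrite mul_mx_diag !mxE -rmorphXn /= mulrAC mulrC.
by rewrite Re_realM mulrC [_^* * _]mulrC.
Qed.

(** Case [predT] of the restricted moment, where every weight is a full row sum of a unitary matrix,
    hence 1. *)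
Lemma moment_expE M k : M \is hermsymmx ->
  complex.Re (\tr (M ^+ k)) = \sum_i eigval M i ^+ k.
Proof.
move=> hM; have := restr_momentE predT k hM.
have -> : restrmx predT = 1%:M by apply/matrixP => i j; rewrite !mxE.
rewrite mul1mx => ->; apply: eq_bigr => i _.
by rewrite /spectral_weight amp2_row_sum ?spectral_unitarymx // mul1r.
Qed.

(* The eigenbases of [M^t* *m M] and [M] are related by a unitary [T], which only
   links equal eigenvalues, and the squared moduli of [T] are doubly stochastic. *)
Lemma trnorm_hermitian M : M \is hermsymmx -> trnorm M = \sum_i `|eigval M i|.
Proof.
move=> hM; have hM' := hermitian_conjTE hM.
rewrite /trnorm hM'; have hM2 : M *m M \is hermsymmx.
  by apply/is_hermitianmxP; rewrite expr0 scale1r trmx_mul map_mxM hM'.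
set S := M *m M; pose V := spectralmx S; pose U := spectralmx M.
have Vu : V \is unitarymx := spectral_unitarymx S.
have Uu : U \is unitarymx := spectral_unitarymx M.
pose T := V *m U^t*.
have Tu : T \is unitarymx by apply: mul_unitarymx Vu _; rewrite trmxC_unitary; exact: Uu.
have SE : S = V^t* *m diag_mx (spectral_diag S) *m V.
  have /orthomx_spectralP := hermitian_normalmx hM2.
  by rewrite (invmx_unitary Vu).
have SE' : S = U^t* *m diag_mx (\row_i ((eigval M i)%:C%C ^+ 2)) *m U.
  exact: (hermitian_expE 2 hM).
have linked : diag_mx (spectral_diag S) *m T =
    T *m diag_mx (\row_i ((eigval M i)%:C%C ^+ 2)).
  have -> : diag_mx (spectral_diag S) *m T = V *m S *m U^t*.
    by rewrite {2}SE /T !mulmxA (unitarymxP Vu) mul1mx.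
  by rewrite SE' !mulmxA mulmxtVK.
(* Where [T i j] is nonzero, [linked] forces [eigval S i] to be the square of [eigval M j];
   elsewhere both sides vanish. *)
have sqrtE i j : amp2 T i j * Num.sqrt (eigval S i) = amp2 T i j * `|eigval M j|.
  have /matrixP /(_ i j) := linked.
  rewrite mul_diag_mx mul_mx_diag mxE [in RHS]mxE [(\row__ _) 0 j]mxE mulrC.
  rewrite eigvalE //; have [T0|Tn0] := eqVneq (T i j) 0.
    by rewrite /amp2 T0 !mul0r.
  move=> /(mulfI Tn0); rewrite -rmorphXn => /(@complexI R) ->.
  by rewrite sqrtr_sqr.
transitivity (\sum_i \sum_j amp2 T i j * Num.sqrt (eigval S i)).
  by apply: eq_bigr => i _; rewrite -mulr_suml amp2_row_sum // mul1r.
rewrite exchange_big; apply: eq_bigr => j _ /=.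
by under eq_bigr do rewrite sqrtE; rewrite -mulr_suml amp2_col_sum // mul1r.
Qed.

(** * Blocks of a Hermitian matrix that preserves a labelling of the basis *)

Variables (K : eqType) (c : 'I_N -> K) (M : 'M[C]_N).
Hypotheses (hM : M \is hermsymmx) (cM : forall i j, M i j != 0 -> c i = c j).

Definition level (q : K) : pred 'I_N := fun i => c i == q.

Definition diag_block (q : K) : 'M[C]_N :=
  restrmx (level q) *m M *m restrmx (level q).

(** A nonzero entry joins indices of equal label, so the row and column indicators agree on it. *)
Lemma diag_block_comm q : restrmx (level q) *m M = M *m restrmx (level q).
Proof.
apply/matrixP => i j; rewrite mul_diag_mx mul_mx_diag !mxE /level.
have [->|/cM ->] := eqVneq (M i j) 0; first by rewrite mulr0 mul0r.
by rewrite mulrC.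
Qed.

Lemma restrmx_idem (P : pred 'I_N) : restrmx P *m restrmx P = restrmx P.
Proof.
rewrite mulmx_diag; congr diag_mx; apply/rowP => i; rewrite !mxE.
by case: (P i); rewrite ?mulr1 ?mulr0.
Qed.

Lemma diag_blockE q : diag_block q = restrmx (level q) *m M.
Proof. by rewrite /diag_block -mulmxA -diag_block_comm mulmxA restrmx_idem. Qed.

(** The projector is idempotent and commutes with powers of [M]. The exponent is positive because
    the zeroth power of the block is the identity, not the projector. *)
Lemma diag_block_exp q k : diag_block q ^+ k.+1 = restrmx (level q) *m M ^+ k.+1.
Proof.
elim: k => [|k IH]; first by rewrite !expr1 diag_blockE.
rewrite exprSr IH [in RHS]exprSr -!mulmxE diag_blockE -mulmxA (mulmxA _ _ M).
suff -> : M ^+ k.+1 *m restrmx (level q) = restrmx (level q) *m M ^+ k.+1.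
  by rewrite !mulmxA restrmx_idem.
by apply/esym; apply: commrX; apply: diag_block_comm.
Qed.

Lemma diag_block_hermitian q : diag_block q \is hermsymmx.
Proof.
apply/is_hermitianmxP; rewrite expr0 scale1r /diag_block !trmx_mul !map_mxM.
rewrite (hermitian_conjTE hM) mulmxA.
suff -> : (restrmx (level q))^t* = restrmx (level q) by [].
apply/matrixP => i j; rewrite !mxE rmorphMn /= conjC_nat eq_sym.
by have [->|] := eqVneq i j.
Qed.

Definition block_moment q k : R := complex.Re (\tr (diag_block q ^+ k)).

Lemma block_momentE q k : block_moment q k.+1 =
  \sum_i spectral_weight M (level q) i * eigval M i ^+ k.+1.
Proof. by rewrite /block_moment diag_block_exp restr_momentE. Qed.

Lemma block_moment_even_ge0 q k : 0 <= block_moment q (2 * k).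
Proof.
rewrite /block_moment moment_expE ?diag_block_hermitian //.
by apply: sumr_ge0 => i _; rewrite exprM exprn_ge0 ?sqr_ge0.
Qed.

Lemma block_ratio_le q :
  Num.sqrt (block_moment q 2 ^+ 3 / block_moment q 4) <=
  \sum_i spectral_weight M (level q) i * `|eigval M i|.
Proof.
have w0 := spectral_weight_ge0 M (level q).
have := weighted_moment_holder (eigval M) w0; rewrite -!block_momentE.
set s := \sum_i _ => holder.
have s0 : 0 <= s by apply: sumr_ge0 => i _; rewrite mulr_ge0.
have := block_moment_even_ge0 q 2; rewrite -[(2 * 2)%N]/4%N le_eqVlt.
(* If the fourth moment vanishes, the quotient is 0 by the convention on inverses. *)
case/predU1P => [<-|p4]; first by rewrite invr0 mulr0 sqrtr0.
by rewrite -[leRHS](ger0_norm s0) -sqrtr_sqr ler_wsqrtr ?ler_pdivrMr.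
Qed.

(** Here the moments are read off the spectrum of the block itself, where all weights are 1, so that
    the fourth is at most the square of the second. *)
Lemma block_moment2_le q :
  Num.sqrt (block_moment q 2) <=
  Num.sqrt (block_moment q 2 ^+ 3 / block_moment q 4).
Proof.
have hb := diag_block_hermitian q; set l := eigval (diag_block q).
have p2 := block_moment_even_ge0 q 1; have p4 := block_moment_even_ge0 q 2.
rewrite -[(2 * 1)%N]/2%N in p2; rewrite -[(2 * 2)%N]/4%N in p4.
apply: ler_wsqrtr.
have p42 : block_moment q 4 <= block_moment q 2 ^+ 2.
  rewrite /block_moment !moment_expE //.
  under eq_bigr do rewrite (exprM _ 2 2).
  by apply: sum_sqr_le => i; rewrite sqr_ge0.
(* A zero fourth moment makes the quotient 0, but it also kills every eigenvalue of the block and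
   hence the second moment. *)
move: p4; rewrite le_eqVlt => /predU1P [p4|p4].
  suff -> : block_moment q 2 = 0 by rewrite expr0n mul0r.
  move: p4; rewrite /block_moment !moment_expE // -/l => /esym/eqP.
  rewrite psumr_eq0 => [/allP l0|i _]; last by rewrite (exprM _ 2 2) sqr_ge0.
  apply: big1 => i _; have := l0 i (mem_index_enum i).
  by rewrite implyTb expf_eq0 => /andP [_ /eqP ->]; rewrite expr0n.
by rewrite ler_pdivlMr // exprS ler_wpM2l.
Qed.

(** A basis state has a single label, so a duplicate-free list counts it at most once, and a full
    row of squared moduli sums to 1. *)
Lemma sum_spectral_weight_le (s : seq K) i : uniq s ->
  \sum_(q <- s) spectral_weight M (level q) i <= 1.
Proof.
move=> us; rewrite -(amp2_row_sum i (spectral_unitarymx M)).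
under eq_bigr do rewrite /spectral_weight big_mkcond.
rewrite exchange_big; apply: ler_sum => x _ /=.
rewrite -big_mkcond big_const_seq iter_addr_0.
rewrite (@eq_count _ (fun q => level q x) (pred1 (c x))) => [|q]; last exact: eq_sym.
by rewrite count_uniq_mem //; case: (_ \in _); rewrite ?amp2_ge0.
Qed.

Lemma sum_block_ratio_le (s : seq K) : uniq s ->
  \sum_(q <- s) Num.sqrt (block_moment q 2 ^+ 3 / block_moment q 4) <= trnorm M.
Proof.
move=> us; rewrite trnorm_hermitian //.
apply: le_trans (ler_sum _ (fun q _ => block_ratio_le q)) _.
rewrite exchange_big; apply: ler_sum => i _ /=.
by rewrite -mulr_suml ler_piMl ?sum_spectral_weight_le.
Qed.

Lemma ler_Re_tr_trnorm : complex.Re (\tr M) <= trnorm M.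
Proof.
rewrite -[M in X in X <= _]expr1 moment_expE // trnorm_hermitian //.
by apply: ler_sum => i _; rewrite expr1 ler_norm.
Qed.

End SpectralWeights.

(** * Charges and the partial transpose in the computational basis *)

Section Charges.
Variables (R : rcfType) (n : nat).
Local Notation C := R[i].
Implicit Types (A B S : {set 'I_n}) (rho : op R 'I_n) (u v : bits 'I_n).

Definition number S u : nat := \sum_(i in S) u i.

Lemma on_qubit_pauliZE (i : 'I_n) (x y : 'I_#|bits 'I_n|) :
  on_qubit i (pauliZ R) x y = ((-1) ^+ ket x i) *+ (x == y).
Proof.
rewrite !mxE; have [->|xy] := eqVneq x y.
  rewrite eqxx mulr1n; case: forallP => [|[]]; rewrite ?mulr1 // => j.
  by rewrite eqxx implybT.
have [xyi|] := eqVneq (ket x i) (ket y i); last by rewrite mulr0n mul0r.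
case: forallP => [agree|]; last by rewrite mulr0.
case/negP: xy; apply/eqP/enum_val_inj/ffunP => j.
by have [->//|ji] := eqVneq j i; have := agree j; rewrite ji => /eqP.
Qed.

(** Each summand is diagonal with entry [(1 - (-1) ^+ b) / 2], which equals the bit [b]. *)
Lemma numopE S : numop R S = diag_mx (\row_x (number S (ket x))%:R).
Proof.
apply/matrixP => x y; rewrite summxE [RHS]mxE [in RHS]mxE natr_sum -sumrMnl.
apply: eq_bigr => i _; rewrite mxE mxE mxE [in X in _ + X]mxE on_qubit_pauliZE.
rewrite -mulrnBl mulrnAr; congr (_ *+ _).
case: (ket x i) => -[|[|//]] ? /=; first by rewrite subrr mulr0.
by rewrite expr1 opprK mulVf // pnatr_eq0.
Qed.

Definition charge A B (x : 'I_#|bits 'I_n|) : C :=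
  (number A (ket x))%:R - (number B (ket x))%:R.

Lemma imbalanceE A B : imbalance R A B = diag_mx (\row_x charge A B x).
Proof.
rewrite /imbalance !numopE tr_diag_mx -raddfB /=; congr diag_mx.
by apply/rowP => x; rewrite !mxE.
Qed.

(** Row by row: a basis vector with [d i = q] lies in the eigenspace and is fixed; any other is
    orthogonal to it, since eigenvectors for [q] vanish at [i], and is killed. *)
Lemma proj_ortho_diag N (d : 'I_N -> C) (q : C) :
  proj_ortho (eigenspace (diag_mx (\row_i d i)) q) = restrmx R (level d q).
Proof.
apply/row_matrixP => i; rewrite rowE row_diag_mx mxE /level.
have [di|di] := eqVneq (d i) q.
  rewrite proj_ortho_id ?scale1r //; apply/eigenspaceP.
  by rewrite -rowE row_diag_mx mxE di.
rewrite scale0r proj_ortho_0 //; apply/orthomx1P.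
have /eigenspaceP E := submx_refl (eigenspace (diag_mx (\row_i d i)) q).
rewrite -rowE; apply/rowP => j; rewrite !mxE.
have /matrixP /(_ j i) := E; rewrite mul_mx_diag !mxE mulrC => /eqP.
by rewrite -subr_eq0 -mulrBl mulf_eq0 subr_eq0 (negbTE di) => /eqP ->; rewrite conjC0.
Qed.

Lemma number_splice_out A B u v : [disjoint A & B] -> number A (splice B u v) = number A u.
Proof.
by move=> AB; apply: eq_bigr => i iA; rewrite ffunE (disjointFr AB).
Qed.

Lemma number_splice_in B u v : number B (splice B u v) = number B v.
Proof. by apply: eq_bigr => i iB; rewrite ffunE iB. Qed.

Lemma number_setC B u : number [set: 'I_n] u = (number (~: B) u + number B u)%N.
Proof.
rewrite /number (bigID (mem B)) /= addnC; congr (_ + _)%N.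
  by apply: eq_bigl => i; rewrite !inE.
by apply: eq_bigl => i; rewrite inE.
Qed.

Lemma comm_numop_number S rho x y : comm_mx rho (numop R S) ->
  rho x y != 0 -> number S (ket x) = number S (ket y).
Proof.
move=> /matrixP /(_ x y); rewrite numopE mul_mx_diag mul_diag_mx !mxE mulrC.
by move=> /[swap] r0 /(mulIf r0) /eqP; rewrite eqr_nat eq_sym => /eqP.
Qed.

(** The entry is that of [rho] between x_A y_B and y_A x_B, so conservation gives N_A(x) + N_B(y) =
    N_A(y) + N_B(x). Rearranged, the sum of charges has become a difference. *)
Lemma ptrans_charge B rho x y : comm_mx rho (numop R [set: 'I_n]) ->
  ptrans B rho x y != 0 -> charge (~: B) B x = charge (~: B) B y.
Proof.
move=> rhoQ; rewrite mxE => /(comm_numop_number rhoQ).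
rewrite /ket !enum_rankK !(number_setC B) !number_splice_in.
have dB : [disjoint ~: B & B] by rewrite -setI_eq0 finset.setIC finset.setICr.
rewrite !number_splice_out // => /(congr1 (fun k => k%:R : C)).
rewrite /charge !natrD /ket => e.
by apply/eqP; rewrite subr_eq addrAC eq_sym subr_eq -e.
Qed.

Lemma ptrans_hermitian B rho : rho \is hermsymmx -> ptrans B rho \is hermsymmx.
Proof.
move=> h; apply/is_hermitianmxP; rewrite expr0 scale1r.
by apply/matrixP => x y; rewrite !mxE -[rho in LHS](hermitian_conjTE h) !mxE.
Qed.

Lemma splice_id B u : splice B u u = u.
Proof. by apply/ffunP => i; rewrite ffunE if_same. Qed.

Lemma tr_ptrans B rho : \tr (ptrans B rho) = \tr rho.
Proof. by apply: eq_bigr => x _; rewrite mxE splice_id enum_valK. Qed.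

Lemma ptmomentE A B rho k q :
  ptmoment A B rho k q = block_moment (charge A B) (ptrans B rho) q k.
Proof.
by rewrite /ptmoment /block /charge_proj imbalanceE proj_ortho_diag.
Qed.

End Charges.

(** * Passage to logarithms *)

Lemma ler_ln_ge1 (R : realType) (x y : R) : 1 <= y -> x <= y -> ln x <= ln y.
Proof.
(* For [x <= 0] the convention [ln x = 0] suffices, as [ln y] is nonnegative. *)
move=> y1 xy; have [x0|x0] := leP x 0; first by rewrite ln0 ?ln_ge0.
by rewrite ler_ln ?posrE // (lt_le_trans x0).
Qed.

Theorem mainTheorem11 (R : realType) (n : nat) (A B : {set 'I_n})
    (AB : B = ~: A) (rho : op R 'I_n) (rho_state : density rho)
    (rhoQ : comm_mx rho (numop R [set: 'I_n])) :
  [/\ forall q : R[i], sector A B rho q -> E4 A B rho q <= lognegativity B rho,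
      E4SR A B rho <= lognegativity B rho
    & E2SR A B rho <= lognegativity B rho].
Proof.
have {AB} -> : A = ~: B by rewrite AB finset.setCK.
case: rho_state => /(ptrans_hermitian B) hM _ tr1.
pose c := @charge R n (~: B) B; set M := ptrans B rho in hM.
have cM i j : M i j != 0 -> c i = c j := ptrans_charge rhoQ.
have norm_ge1 : 1 <= trnorm M.
  by apply: le_trans (ler_Re_tr_trnorm hM); rewrite tr_ptrans tr1.
(* Finiteness of the set of sectors turns the set-indexed sums into sums over a duplicate-free list,
   as [sum_block_ratio_le] requires. *)
have [s us sumE] : exists2 s : seq R[i], uniq s &
    forall F : R[i] -> R, \sum_(q \in sectors (~: B) B rho) F q = \sum_(q <- s) F q.
  exists (finmap.enum_fset (fset_set (sectors (~: B) B rho))) => [|F].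
    exact: finmap.fset_uniq.
  by rewrite fsbig_finite //; exact: finite_sectors.
have ratio_sum_le := sum_block_ratio_le hM cM us.
split.
- move=> q _; rewrite /E4 !ptmomentE -/c -/M.
  (* A single sector is the case of a one-element list. *)
  set x := _ / _; have : Num.sqrt x <= trnorm M.
    by have := sum_block_ratio_le hM cM (isT : uniq [:: q]); rewrite big_seq1.
  (* The factor one half is moved across as a square of the trace norm, leaving [x <= trnorm M ^+ 2]
     to prove. *)
  move=> xM; rewrite ler_pdivrMl // mulr_natl -lnXn ?(lt_le_trans ltr01) //.
  apply: ler_ln_ge1; first exact: exprn_ege1.
  have [x0|x0] := leP x 0; first by rewrite (le_trans x0) ?sqr_ge0.
  by rewrite -(sqr_sqrtr (ltW x0)) lerXn2r ?nnegrE ?sqrtr_ge0 // (le_trans ler01).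
- apply: ler_ln_ge1 norm_ge1 _; rewrite sumE; apply: le_trans ratio_sum_le.
  by apply: ler_sum => q _; rewrite (ptmomentE _ _ _ 2) (ptmomentE _ _ _ 4).
- apply: ler_ln_ge1 norm_ge1 _; rewrite sumE; apply: le_trans ratio_sum_le.
  by apply: ler_sum => q _; rewrite ptmomentE (block_moment2_le _ hM).
Qed.
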